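(* Let $\lambda>0$ and let $N(t)$, $t>0$, be a homogeneous Poisson process with intensity $\lambda$, with event times $T_j=\inf\{t>0: N(t)=j\}$. Let $\widehat{N}(t)$, $t>0$, be the process whose $j$-th event time $\widehat{T}_j$ satisfies $\widehat{T}_j\overset{law}{=}T_{2j}$ and for which $$\Pr\{\widehat{N}(t)=k\}=\Pr\{N(t)=2k\}+\Pr\{N(t)=2k+1\},\qquad k\ge 0.$$ Then the probability distribution $\widehat{p}_k(t)=\Pr\{\widehat{N}(t)=k\}$ solves the equation $$\frac{d^{2}\widehat{p}_k}{dt^{2}}+2\lambda\frac{d\widehat{p}_k}{dt}=-\lambda^{2}(\widehat{p}_k-\widehat{p}_{k-1}),\qquad k\ge 0,$$ where $\widehat{p}_{-1}(t)=0$.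
   Context: $\widehat{N}$ may be thought of as the process counting only the even-indexed events of $N$: $\widehat N(t)=k$ when $t\in[T_{2k},T_{2k+2})$ (with $T_0=0$). *)

(* Defs.v *)
From HB Require Import structures.
From mathcomp Require Import all_boot all_order all_algebra.
From mathcomp Require Import all_classical all_reals all_analysis measurable_realfun.

Set Implicit Arguments.
Unset Strict Implicit.
Unset Printing Implicit Defensive.

Import Order.TTheory GRing.Theory Num.Theory.
Import numFieldNormedType.Exports.

Local Open Scope classical_set_scope.
Local Open Scope ring_scope.

(* A process is a family of nat-valued random variables indexed by R;
   only the times t >= 0 are ever constrained or used. *)
Definition counting_process d (Omega : measurableType d) (R : realType)
    (P : probability Omega R) (N : R -> {RV P >-> nat}) : Prop :=
  [/\ forall w, N 0 w = 0%N,
      forall w (s t : R), 0 <= s -> s <= t -> (N s w <= N t w)%N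
    & forall w (t : R), 0 <= t -> N s w @[s --> t^'+] --> N t w].

(* Some of the sets A i may be setT, so the product rule over the whole family
   contains the product rule over every subfamily; every subset of nat is
   measurable. *)
Definition mutually_independent d (Omega : measurableType d) (R : realType)
    (P : probability Omega R) (n : nat) (X : 'I_n -> Omega -> nat) : Prop :=
  forall A : 'I_n -> set nat,
    P (\bigcap_(i in [set: 'I_n]) (X i @^-1` A i))
    = (\prod_(i < n) P (X i @^-1` A i))%E.

(* The truncated subtraction of nat is exact here, the paths being monotone. *)
Definition increment d (Omega : measurableType d) (R : realType)
    (P : probability Omega R) (N : R -> {RV P >-> nat}) (s t : R)
    (w : Omega) : nat :=
  (N t w - N s w)%N.

Definition poisson_process d (Omega : measurableType d) (R : realType)
    (P : probability Omega R) (lambda : R) (N : R -> {RV P >-> nat}) : Prop :=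
  [/\ counting_process N,
      forall (n : nat) (t : nat -> R), 0 <= t 0%N ->
        (forall i, t i <= t i.+1) ->
        mutually_independent P (fun i : 'I_n => increment N (t i) (t i.+1))
    & forall s t : R, 0 <= s -> s < t -> forall k : nat,
        P [set w | increment N s t w = k]
        = (poisson_pmf (lambda * (t - s)) k)%:E].

(* Extended-real valued: the infimum is +oo on the paths that never visit j.
   For a counting process the value at j = 0 is 0. *)
Definition event_time d (Omega : measurableType d) (R : realType)
    (P : probability Omega R) (N : R -> {RV P >-> nat}) (j : nat)
    (w : Omega) : \bar R :=
  ereal_inf [set t%:E | t in [set t : R | 0 < t /\ N t w = j]].

(* Meaningful for measurable X and Y; the event times of a counting process
   are measurable because its paths are right-continuous. *)
Definition eq_law d (Omega : measurableType d) (R : realType)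
    (P : probability Omega R) (X Y : Omega -> \bar R) : Prop :=
  forall A : set (\bar R), measurable A -> P (X @^-1` A) = P (Y @^-1` A).

(* The state k ranges over the integers, with probability 0 for k < 0. *)
Definition state_prob d (Omega : measurableType d) (R : realType)
    (P : probability Omega R) (N : R -> {RV P >-> nat}) (k : int)
    (t : R) : R :=
  if k is Posz n then fine (P [set w | N t w = n]) else 0.

(* Main.v *)
(* On t > 0 the state probabilities of N are the Poisson weights
   q_n(t) = (lambda t)^n e^(- lambda t) / n!, which satisfy
   q_n' = lambda (q_(n-1) - q_n) with q_(-1) = 0. Two applications of this to
   q_2k + q_(2k+1), the k-th state probability of Nhat, give the equation. *)
Require Import Defs.
From HB Require Import structures.
From mathcomp Require Import all_boot all_order all_algebra.
From mathcomp Require Import all_classical all_reals all_analysis measurable_realfun.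
From mathcomp Require Import ring.

Set Implicit Arguments.
Unset Strict Implicit.
Unset Printing Implicit Defensive.

Import Order.TTheory GRing.Theory Num.Theory.
Import numFieldNormedType.Exports.

Local Open Scope classical_set_scope.
Local Open Scope ring_scope.

(* The weight of index n sits at position n + 2, below two zeros, so that the
   recurrence on derivatives and the values p_k, p_(k-1) need no case
   distinction. *)
Definition shifted_poisson_weight (R : realType) (lambda : R) (m : nat) (t : R)
    : R :=
  if m is n.+2 then (lambda * t) ^+ n * n`!%:R^-1 * expR (- (lambda * t))
  else 0.

(** By the product rule: the factor [n] from the power cancels in [n!] and gives the weight one
    position lower, while the exponential gives the negative term. *)
Lemma is_derive_shifted_poisson_weight (R : realType) (lambda : R) (m : nat)
    (t : R) :
  is_derive t 1 (shifted_poisson_weight lambda m.+1)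
    (lambda * (shifted_poisson_weight lambda m t
               - shifted_poisson_weight lambda m.+1 t)).
Proof.
have dM : is_derive t 1 (fun s : R => lambda * s) lambda.
  by apply: is_derive_eq; rewrite /GRing.scale /= mulr1.
have dE : is_derive t 1 (fun s : R => expR (- (lambda * s)))
    (expR (- (lambda * t)) * - lambda).
  exact: (@is_derive1_comp _ expR (fun s => - (lambda * s))).
case: m => [|n] /=.
  by rewrite subrr mulr0; exact: is_derive_cst.
have dX : is_derive t 1 (fun s : R => (lambda * s) ^+ n)
    ((n%:R * (lambda * t) ^+ n.-1) *: lambda).
  rewrite (_ : (fun s => _) = (fun s => lambda * s) ^+ n).
    exact: is_deriveX.
  by rewrite exprfctE.
rewrite (_ : shifted_poisson_weight lambda n.+2 =
    (n`!%:R^-1 *: (fun s => (lambda * s) ^+ n))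
    * (fun s => expR (- (lambda * s)))); last first.
  by apply/funext => s; rewrite !fctE /GRing.scale /= (mulrC n`!%:R^-1).
apply: is_derive_eq.
(* For [n = 0] the truncated exponent [n.-1] carries coefficient 0, and the weight below is a
   padding zero. *)
rewrite !fctE /GRing.scale /=; case: n {dX} => [|n] /=.
  by rewrite expr0 fact0 invr1; ring.
rewrite exprS factS natrM; field.
by rewrite nat1r !pnatr_eq0 -lt0n fact_gt0.
Qed.

Lemma poisson_process_stateE (R : realType) (d : measure_display)
    (Omega : measurableType d) (P : probability Omega R) (lambda : R)
    (N : R -> {RV P >-> nat}) (n : nat) (t : R) :
  0 < lambda -> poisson_process lambda N -> 0 < t ->
  P [set w | N t w = n] = (shifted_poisson_weight lambda n.+2 t)%:E.
Proof.
move=> lambda_gt0 [[N0 _ _] _ Npmf] t_gt0.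
have := Npmf 0 t (lexx _) t_gt0 n.
(* [poisson_pmf] branches on the sign of its rate, here [lambda * t > 0]. *)
rewrite /poisson_pmf subr0 mulr_gt0// => <-.
by congr (P _); apply/seteqP; split=> w /=; rewrite /increment N0 subn0.
Qed.

Theorem theorem3p3 (R : realType) (d : measure_display)
    (Omega : measurableType d) (P : probability Omega R) (lambda : R)
    (N Nhat : R -> {RV P >-> nat}) :
  0 < lambda ->
  poisson_process lambda N ->
  counting_process Nhat ->
  (forall j : nat, (0 < j)%N ->
    eq_law P (event_time Nhat j) (event_time N (2 * j)%N)) ->
  (forall (t : R) (k : nat), 0 < t ->
    P [set w | Nhat t w = k]
    = (P [set w | N t w = (2 * k)%N] + P [set w | N t w = (2 * k + 1)%N])%E) ->
  forall (k : nat) (t : R), 0 < t ->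
    let p := state_prob Nhat in
    [/\ derivable (p k%:Z) t 1,
        derivable (p k%:Z)^`()%classic t 1
      & (p k%:Z)^`(2)%classic t + 2 * lambda * (p k%:Z)^`()%classic t
        = - lambda ^+ 2 * (p k%:Z t - p (k%:Z - 1) t)].
Proof.
move=> lambda_gt0 PN _ _ Nhat_pmf k t t_gt0 p.
pose W := shifted_poisson_weight lambda.
have dW m (s : R) : is_derive s 1 (W m.+1) (lambda * (W m s - W m.+1 s)).
  exact: is_derive_shifted_poisson_weight.
have pE (n : nat) (s : R) : 0 < s ->
    p n%:Z s = W (2 * n).+2 s + W (2 * n).+3 s.
  move=> s_gt0; rewrite /p /state_prob /= Nhat_pmf// addn1.
  by rewrite !(poisson_process_stateE _ lambda_gt0 PN).
(* Lowering [k] by one lowers positions by two; for [k = 0] both terms are the padding zeros. *)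
have predE : p (k%:Z - 1) t = W (2 * k)%N t + W (2 * k).+1 t.
  case: k => [|n]; first by rewrite /= addr0.
  have -> : n.+1%:Z - 1 = n%:Z by rewrite -natz mulrSr natz addrK.
  by rewrite pE// mulnS.
have dp (s : R) : 0 < s ->
    is_derive s 1 (p k%:Z) (lambda * (W (2 * k).+1 s - W (2 * k).+3 s)).
  move=> s_gt0.
  (* The formula for [p] is known only at positive times, hence near [s]. In the sum of the two
     derivatives [W (2 * k).+2] cancels. *)
  apply: (@near_eq_is_derive _ _ _ (W (2 * k).+2 \+ W (2 * k).+3)).
    by near=> u; rewrite pE//; near: u; exact: lt_nbhsr.
  by apply: is_derive_eq; ring.
have ddp : is_derive t 1 (p k%:Z)^`()%classic
    (lambda ^+ 2 * (W (2 * k)%N t - W (2 * k).+1 t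
                    - W (2 * k).+2 t + W (2 * k).+3 t)).
  apply: (@near_eq_is_derive _ _ _
    (lambda *: (W (2 * k).+1 \- W (2 * k).+3))).
    near=> u; rewrite derive1E; have u_gt0 : 0 < u by near: u; exact: lt_nbhsr.
    by rewrite (@derive_val _ _ _ _ _ _ _ (dp u u_gt0)).
  by apply: is_derive_eq; rewrite /GRing.scale /=; ring.
have dpt := dp t t_gt0.
split; [exact: ex_derive | exact: ex_derive |].
(* With [a, b, c, d] the values of [W] at positions [2k] to [2k + 3], the claim is [(a - b - c + d)
   + 2 (b - d) = (a + b) - (c + d)], times [lambda ^+ 2]. *)
rewrite derive1nS derive1n1 derive1E derive_val derive1E derive_val predE pE//.
ring.
Unshelve. all: by end_near. Qed.
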